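(* The sequence of operators $\{\mathcal{GK}_n:L^1[0,\pi]\to L^1[0,\pi]\}_{n\in\mathbb{N}}$ is uniformly bounded on $L^1[0,\pi]$; that is, there is a constant $C>0$ such that $\|\mathcal{GK}_n(f)\|_1\le C\|f\|_1$ for all $n\in\mathbb{N}$ and all $f\in L^1[0,\pi]$.
   Context: For $n\in\mathbb{N}$ and $k=1,\dots,n$ let $\theta_k^{(n)}=\frac{(2k-1)\pi}{2n}$ and, for real $\theta$, let $$P_k(\theta)=(-1)^{k+1}\frac{\cos(n\theta)\sin\theta_k^{(n)}}{n(\cos\theta-\cos\theta_k^{(n)})}$$ (the dependence on $n$ is suppressed; $P_k$ is extended by continuity at the removable singularities, so it is a polynomial in $\cos\theta$, namely the fundamental Lagrange polynomial at the Chebyshev nodes $\cos\theta_k^{(n)}$ evaluated at $\cos\theta$). The Grünwald–Kantorovich operators are defined for integrable $f$ on $[0,\pi]$ and $\theta\in[0,\pi]$ by $$\mathcal{GK}_n(f)(\theta)=\frac{n}{\pi}\sum_{k=1}^n\left(\int_{\theta_k^{(n)}}^{\theta_k^{(n)}+\frac{\pi}{2n}}f(t)\,dt\right)\left\{P_k\left(\theta+\frac{\pi}{2n}\right)+P_k\left(\theta-\frac{\pi}{2n}\right)\right\}.$$ *)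

(* Defs.v *)
From HB Require Import structures.
From mathcomp Require Import all_boot all_order all_algebra.
From mathcomp Require Import all_classical all_reals all_analysis.

Set Implicit Arguments.
Unset Strict Implicit.
Unset Printing Implicit Defensive.

Import Order.TTheory GRing.Theory Num.Theory.
Import numFieldNormedType.Exports.

Local Open Scope classical_set_scope.
Local Open Scope ring_scope.

Section GrunwaldKantorovich.
Context {R : realType}.
Implicit Types (n k : nat) (t : R) (f : R -> R).

Definition cheb_angle n k : R := (2 * k%:R - 1) * pi / (2 * n%:R).

Definition fund_quot n k t : R :=
  (-1) ^+ k.+1 * (cos (n%:R * t) * sin (cheb_angle n k)
                  / (n%:R * (cos t - cos (cheb_angle n k)))).

(* Continuous extension of [fund_quot]: since x / 0 = 0 in the library, the
   removable singularities are filled in with the punctured limit. *)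
Definition fundP n k t : R :=
  if cos t == cos (cheb_angle n k)
  then lim (fund_quot n k s @[s --> t^'])
  else fund_quot n k t.

Definition GK n f t : R :=
  n%:R / pi *
  \sum_(1 <= k < n.+1)
    (\int[lebesgue_measure]_(s in
        `[cheb_angle n k, cheb_angle n k + pi / (2 * n%:R)]) f s)
    * (fundP n k (t + pi / (2 * n%:R)) + fundP n k (t - pi / (2 * n%:R))).

(* L^1[0, pi] is handled through real-valued representatives defined on the
   whole line; their values outside [0, pi] are irrelevant. *)
Definition inL1 f : Prop :=
  lebesgue_measure.-integrable `[0, pi] (EFin \o f).

Definition L1norm f : \bar R :=
  (\int[lebesgue_measure]_(t in `[0%R, pi]) `|f t|%:E)%E.

End GrunwaldKantorovich.

(* Main.v *)
Require Import Defs.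
From mathcomp Require Import all_boot all_order all_algebra.
From mathcomp Require Import all_classical all_reals all_analysis.
From mathcomp Require Import measurable_realfun ring lra.
Import Order.TTheory GRing.Theory Num.Theory.
Local Open Scope ring_scope.

(* Write h = pi / (2n), x_k = (2k - 1) h and
   K_k(t) = P_k(t + h) + P_k(t - h).  By the Christoffel-Darboux formula
   P_k(t) = (1/n) (1 + 2 sum_(1 <= j < n) cos (j x_k) cos (j t)), so P_k is
   continuous and |P_k| <= 2.  With
     X = sin^2((t + x_k)/2) - sin^2(h/2),  Y = sin^2((t - x_k)/2) - sin^2(h/2)
   one has X - Y = sin t sin x_k and
     K_k(t) X Y = (-1)^k sin(n t) sin(h) / (2n) * (X - Y).
   When |t - x_k| > 2h, Y is positive and of order (t - x_k)^2, and
   0 <= X - Y <= X, hence |K_k(t)| = O(h^2 / (t - x_k)^2).  Both regimes give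
   |K_k(t)| <= 20 / (1 + ((t - x_k) / h)^2), whose integral is at most
   20 pi h = 10 pi^2 / n.  As the intervals [x_k, x_k + h] are disjoint subsets
   of [0, pi], the operator norm of GK_n is at most (n/pi) (10 pi^2 / n). *)

(** * Chebyshev nodes and the cosine-sum form of the fundamental polynomials *)

Section DirichletForm.
Context {R : realType}.
Import numFieldNormedType.Exports.
Local Open Scope classical_set_scope.
Implicit Types (n k : nat) (s t u x y : R).

Definition half_step n : R := pi / (2 * n%:R).

Lemma half_step_gt0 n : (0 < n)%N -> 0 < half_step n.
Proof. by move=> n0; rewrite divr_gt0 ?pi_gt0// mulr_gt0// ltr0n. Qed.

(** A shift by [half_step n] is a quarter period of cos(n t); this exchanges cosine and sine in the
    kernel. *)
Lemma natr_half_step n : (0 < n)%N -> n%:R * half_step n = pi / 2.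
Proof.
move=> n0; have : n%:R != 0 :> R by rewrite pnatr_eq0 -lt0n.
by rewrite /half_step => ?; field.
Qed.

Lemma cheb_angleE n k :
  cheb_angle n k = (2 * k%:R - 1) * half_step n :> R.
Proof. by rewrite /cheb_angle /half_step mulrA. Qed.

(** The factor 2k - 1 runs from 1 to 2n - 1, and 2n h = pi. This distance from both endpoints gives
    sin x_k > 0 and keeps [x_k, x_k + h] inside [0, pi]. *)
Lemma cheb_angle_itv n k : (0 < n)%N -> (0 < k <= n)%N ->
  half_step n <= cheb_angle n k <= pi - half_step n.
Proof.
move=> n0 /andP[k0 kn]; rewrite cheb_angleE.
have h0 := half_step_gt0 n n0; have nh := natr_half_step n n0.
have k1 : 1 <= k%:R :> R by rewrite ler1n.
have kn1 : k%:R <= n%:R :> R by rewrite ler_nat.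
by apply/andP; split; nra.
Qed.

(** Since n x_k = k pi - pi/2, raising k by one adds pi to the angle and flips both signs. *)
Lemma cos_sin_cheb_angle n k : (0 < n)%N -> (0 < k)%N ->
  cos (n%:R * cheb_angle n k) = 0 :> R /\
  sin (n%:R * cheb_angle n k) = (-1) ^+ k.+1 :> R.
Proof.
move=> n0; have nh := natr_half_step n n0.
have -> : n%:R * cheb_angle n k = k%:R * pi - pi / 2 :> R.
  by rewrite cheb_angleE; move: nh => /(congr1 ( *%R (2 * k%:R - 1))); nra.
elim: k => // -[_ _|k IH _].
  rewrite mul1r sinBpihalf cosBpihalf sinpi cospi; split=> //; ring.
have [IHc IHs] := IH isT.
have -> : k.+2%:R * pi - pi / 2 = (k.+1%:R * pi - pi / 2) + pi :> R.
  by rewrite -[k.+2%:R]natr1; ring.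
by rewrite cosDpi sinDpi IHc IHs oppr0 [(-1) ^+ k.+3]exprS mulN1r.
Qed.

(** The reproducing kernel of the Chebyshev polynomials of degree below n; the factor 2 normalises
    the terms of positive degree. *)
Definition dirichlet_sum n x s : R :=
  1 + 2 * \sum_(1 <= j < n) cos (j%:R * x) * cos (j%:R * s).

(** Induction on n through the three-term recurrence [cosS]. Keeping cos s - cos x as a factor makes
    the identity valid at the singularities too. *)
Lemma christoffel_darboux n x s : (0 < n)%N ->
  (cos s - cos x) * dirichlet_sum n x s =
  cos (n%:R * s) * cos (n.-1%:R * x) - cos (n.-1%:R * s) * cos (n%:R * x).
Proof.
case: n => // n _; rewrite /dirichlet_sum; elim: n => [|n IH].
  by rewrite big_geq//= !mul0r !mul1r cos0; ring.
rewrite big_nat_recr//= [_ + cos _ * cos _]addrC !mulrDr -mulrDr.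
move: IH; rewrite mulrDr => IH.
have cosS y :
    cos (n.+2%:R * y) = 2 * cos y * cos (n.+1%:R * y) - cos (n%:R * y).
  have -> : n.+2%:R * y = n.+1%:R * y + y by rewrite -[n.+2%:R]natr1; ring.
  have -> : n%:R * y = n.+1%:R * y - y by rewrite -[n.+1%:R]natr1; ring.
  by rewrite cosD cosB; ring.
by rewrite !cosS; move: IH => /=; set S := \sum_(_ <= _ < _) _; nra.
Qed.

Lemma continuous_dirichlet_sum n x : continuous (dirichlet_sum n x).
Proof.
move=> s; apply: cvgD; first exact: cvg_cst.
apply: cvgM; first exact: cvg_cst.
apply: cvg_big => [|i _]; first exact: add_continuous.
  apply: cvgM; first exact: cvg_cst.
  apply: continuous_comp; last exact: continuous_cos.
  by apply: cvgM; [exact: cvg_cst|exact: cvg_id].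
Qed.

Lemma norm_dirichlet_sum_le n x s : (0 < n)%N ->
  `|dirichlet_sum n x s| <= 2 * n%:R.
Proof.
move=> n0; rewrite (le_trans (ler_normD _ _))// normr1 normrM ger0_norm//.
have : `|\sum_(1 <= j < n) cos (j%:R * x) * cos (j%:R * s)| <= n%:R - 1.
  rewrite (le_trans (ler_norm_sum _ _ _))//.
  have -> : n%:R - 1 = \sum_(1 <= j < n) 1 :> R.
    by rewrite sumr_const_nat natrB.
  by apply: ler_sum => j _; rewrite normrM mulr_ile1// cos_max.
by lra.
Qed.

(** At a node the right-hand side of [christoffel_darboux] collapses: cos(n x_k) = 0 and cos((n - 1)
    x_k) = (-1)^(k+1) sin x_k. *)
Lemma fund_quotE n k s : (0 < n)%N -> (0 < k)%N ->
  cos s != cos (cheb_angle n k) ->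
  fund_quot n k s = n%:R^-1 * dirichlet_sum n (cheb_angle n k) s.
Proof.
move=> n0 k0 cs; have := christoffel_darboux n (cheb_angle n k) s n0.
have [c0 s1] := cos_sin_cheb_angle n k n0 k0.
have nN0 : n%:R != 0 :> R by rewrite pnatr_eq0 -lt0n.
have -> : n.-1%:R * cheb_angle n k =
    n%:R * cheb_angle n k - cheb_angle n k :> R.
  by rewrite -subn1 natrB//; ring.
rewrite cosB c0 s1 mul0r add0r mulr0 subr0 /fund_quot => CD.
have cs0 : cos s - cos (cheb_angle n k) != 0 by rewrite subr_eq0.
rewrite -[dirichlet_sum _ _ _](mulKf cs0) CD.
by field; rewrite cs0.
Qed.

Lemma cos_subr s t :
  cos s - cos t = - 2 * sin ((s + t) / 2) * sin ((s - t) / 2) :> R.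
Proof.
have Es : s = (s + t) / 2 + (s - t) / 2 by field.
have Et : t = (s + t) / 2 - (s - t) / 2 by field.
by rewrite [in cos s]Es [in cos t]Et cosD cosB; ring.
Qed.

(** In the product form of cos s - cos t, one sine tends to sin t and the other, for |s - t| < 1,
    vanishes only at s = t. So the removable singularities are isolated. *)
Lemma cos_near_neq t : sin t != 0 -> \forall s \near t^', cos s != cos t.
Proof.
move=> st0.
have cs : (fun s => sin ((s + t) / 2)) s @[s --> t] --> sin t.
  rewrite (_ : sin t = sin ((t + t) / 2)); last by congr sin; field.
  apply: continuous_cvg; first exact: continuous_sin.
  by apply: cvgM; [apply: cvgD; [exact: cvg_id|exact: cvg_cst]|exact: cvg_cst].
near=> s.
have s1 : sin ((s + t) / 2) != 0.
  near: s; apply: nbhs_dnbhs; exact: (cvgr_neq0 _ cs).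
have st : s != t by near: s; exact: nbhs_dnbhs_neq.
have st1 : `|s - t| < 1.
  near: s; apply: nbhs_dnbhs; apply/nbhs_ballP.
  by exists 1 => //= s; rewrite /ball/= distrC.
rewrite -subr_eq0 cos_subr !mulf_neq0//.
have : s - t != 0 by rewrite subr_eq0.
move: (s - t) st1 => d; rewrite ltr_norml => /andP[d1 d2] d0.
have := pi_ge2 R => p2; case: (ltgtP d 0) d0 => // dlt _.
  have : 0 < sin (- (d / 2)) by apply: sin_gt0_pi; lra.
  by rewrite sinN oppr_gt0 => /lt_eqF ->.
by rewrite gt_eqF// sin_gt0_pi//; lra.
Unshelve. all: by end_near.
Qed.

(** Away from the singularities this is [fund_quotE]; at one of them, the punctured limit of the
    quotient is that of a continuous function agreeing with it nearby. *)
Lemma fundPE n k t : (0 < n)%N -> (0 < k <= n)%N ->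
  fundP n k t = n%:R^-1 * dirichlet_sum n (cheb_angle n k) t.
Proof.
move=> n0 kn; have k0 : (0 < k)%N by case/andP: kn.
rewrite /fundP; case: ifPn => [/eqP ct|]; last exact: fund_quotE.
apply/cvg_lim => //; apply: (@cvg_trans _
  (n%:R^-1 * dirichlet_sum n (cheb_angle n k) s @[s --> t^'])); last first.
  apply: cvg_within_filter.
  by apply: cvgM; [exact: cvg_cst|exact: continuous_dirichlet_sum].
apply: near_eq_cvg.
have sth : sin (cheb_angle n k) != 0 :> R.
  rewrite gt_eqF// sin_gt0_pi//.
  have := cheb_angle_itv n k n0 kn; have := half_step_gt0 n n0; lra.
(* Equal cosines give equal squared sines, and the sine of the node is positive. *)
have st : sin t != 0.
  by rewrite -sqrf_eq0 sin2cos2 ct -sin2cos2 sqrf_eq0.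
by apply: filterS (cos_near_neq _ st) => s cs; rewrite fund_quotE// -ct.
Qed.

(** * Elementary inequalities for the sine *)

Lemma sin_ge_half x : 0 <= x <= pi / 2 -> x / 2 <= sin x.
Proof.
(* By the mean value theorem sin y >= y cos y, so sin x = 2 sin y cos y >= 2 y cos^2 y, and cos^2 y
   = (1 + cos x) / 2 >= 1/2. *)
move=> /andP[x0 xp]; pose y := x / 2.
have y0 : 0 <= y by rewrite /y; lra.
have -> : x = y *+ 2 by rewrite /y -mulr_natr; lra.
have cy : 1 / 2 <= cos y ^+ 2.
  have : 0 <= cos (y *+ 2).
    by apply: cos_ge0_pihalf; rewrite /y -mulr_natr; have := pi_gt0 R; lra.
  by rewrite cos_mulr2n -mulr_natr; lra.
have c0 : 0 <= cos y.
  by apply: cos_ge0_pihalf; rewrite /y; have := pi_gt0 R; lra.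
have [c cy1 Ec] : exists2 c, c \in `[0, y]%R & sin y - sin 0 = cos c * (y - 0).
  apply: (@MVT_segment R sin cos) => //.
  by apply: continuous_in_subspaceT => z _; exact: continuous_sin.
move: Ec; rewrite sin0 !subr0 => Ec.
have [c_ge0 c_ley] : 0 <= c /\ c <= y by move: cy1; rewrite in_itv => /andP.
have cc : cos y <= cos c.
  have cI : c \in `[0, pi]%R.
    by rewrite in_itv/=; move: xp; rewrite /y in c_ley *; have := pi_gt0 R; lra.
  have yI : y \in `[0, pi]%R.
    by rewrite in_itv/= /y; have := pi_gt0 R; lra.
  by rewrite leNgt ltr_cos// -leNgt.
rewrite sin_mulr2n Ec.
suff : 1/2 * y <= cos y * (cos c * y) by move: (_ * (_ * _)) => z; lra.
by rewrite mulrA ler_wpM2r// (le_trans cy)// expr2 ler_wpM2l.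
Qed.

Lemma norm_sin_le x : 0 <= x -> `|sin x| <= x.
Proof.
move=> x0.
have [c _] : exists2 c, c \in `[0, x]%R & sin x - sin 0 = cos c * (x - 0).
  apply: (@MVT_segment R sin cos) => //.
  by apply: continuous_in_subspaceT => z _; exact: continuous_sin.
rewrite sin0 !subr0 => ->; rewrite normrM (ger0_norm x0).
by rewrite -[leRHS]mul1r ler_wpM2r ?cos_max.
Qed.

(** The difference of squares factors as sin((x + y)/2) sin((x - y)/2). Both arguments lie in
    [0, pi/2], so [sin_ge_half] applies to each and the 16 is 4 * 4. *)
Lemma sin2_subr_ge x y : 0 <= y -> y <= x -> x + y <= pi ->
  (x ^+ 2 - y ^+ 2) / 16 <= sin (x / 2) ^+ 2 - sin (y / 2) ^+ 2.
Proof.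
move=> y0 yx xy.
have -> : sin (x / 2) ^+ 2 - sin (y / 2) ^+ 2 =
    sin ((x + y) / 2) * sin ((x - y) / 2).
  transitivity (sin (x / 2) ^+ 2 * cos (y / 2) ^+ 2 -
                cos (x / 2) ^+ 2 * sin (y / 2) ^+ 2).
    by rewrite !cos2sin2; ring.
  by rewrite !mulrDl mulNr sinD sinB; ring.
have := @sin_ge_half ((x + y) / 2); have := @sin_ge_half ((x - y) / 2) => H1 H2.
have {}H1 := H1 ltac:(lra); have {}H2 := H2 ltac:(lra).
have := ler_pM _ _ H1 H2 => /(_ ltac:(lra) ltac:(lra)); lra.
Qed.

End DirichletForm.

(** * Pointwise decay of the kernel away from its node *)

Section KernelBound.
Context {R : realType}.
Import numFieldNormedType.Exports.
Local Open Scope classical_set_scope.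
Implicit Types (n k : nat) (s t u x y : R).

Definition GK_kernel n k t : R :=
  fundP n k (t + half_step n) + fundP n k (t - half_step n).

Lemma norm_fundP_le n k t : (0 < n)%N -> (0 < k <= n)%N -> `|fundP n k t| <= 2.
Proof.
move=> n0 kn; rewrite fundPE// normrM ger0_norm ?invr_ge0//.
by rewrite ler_pdivrMl ?ltr0n// mulrC norm_dirichlet_sum_le.
Qed.

(** Clearing the denominator of the quotient spares any case distinction at the singularities. *)
Lemma fundP_mul_cos_subr n k t : (0 < n)%N -> (0 < k <= n)%N ->
  fundP n k t * (cos t - cos (cheb_angle n k)) =
  (-1) ^+ k.+1 * (cos (n%:R * t) * sin (cheb_angle n k) / n%:R).
Proof.
move=> n0 kn; have k0 : (0 < k)%N by case/andP: kn.
have [c0 s1] := @cos_sin_cheb_angle R n k n0 k0.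
rewrite fundPE// -[LHS]mulrA [dirichlet_sum _ _ _ * _]mulrC.
rewrite christoffel_darboux//.
have -> : n.-1%:R * cheb_angle n k =
    n%:R * cheb_angle n k - cheb_angle n k :> R.
  by rewrite -subn1 natrB//; ring.
by rewrite cosB c0 s1; ring.
Qed.

(** The shifts by h and -h turn cos(n t) into -sin(n t) and sin(n t). Over the common denominator A
    B the numerators thus combine to A - B = -2 sin t sin h, and this cancellation gains the factor
    sin h. Writing sin t sin x as X - Y later lets X be divided out, however small it is. *)
Lemma GK_kernel_identity n k t : (0 < n)%N -> (0 < k <= n)%N ->
  let h := half_step n in let x := cheb_angle n k in
  let X := sin ((t + x) / 2) ^+ 2 - sin (h / 2) ^+ 2 in
  let Y := sin ((t - x) / 2) ^+ 2 - sin (h / 2) ^+ 2 in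
  X - Y = sin t * sin x /\
  GK_kernel n k t * (X * Y) =
    (-1) ^+ k * (sin (n%:R * t) * sin h / (2 * n%:R)) * (X - Y).
Proof.
move=> n0 kn h x X Y.
have sin2_subr a b :
    sin ((a + b) / 2) ^+ 2 - sin ((a - b) / 2) ^+ 2 = sin a * sin b :> R.
  transitivity ((sin ((a + b) / 2) - sin ((a - b) / 2)) *
                (sin ((a + b) / 2) + sin ((a - b) / 2))); first by ring.
  rewrite !mulrDl mulNr sinD sinB.
  have -> : sin a = 2 * sin (a / 2) * cos (a / 2).
    by rewrite {1}(_ : a = (a / 2) *+ 2) ?sin_mulr2n; [ring|field].
  have -> : sin b = 2 * sin (b / 2) * cos (b / 2).
    by rewrite {1}(_ : b = (b / 2) *+ 2) ?sin_mulr2n; [ring|field].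
  by ring.
have XY : X - Y = sin t * sin x by rewrite /X /Y -sin2_subr; ring.
split=> //.
set A := cos (t + h) - cos x; set B := cos (t - h) - cos x.
have AB : A * B = 4 * (X * Y).
  have EX : X = sin ((t + h + x) / 2) * sin ((t - h + x) / 2).
    by rewrite -sin2_subr /X; congr (_ ^+ 2 - _ ^+ 2); congr sin; field.
  have EY : Y = sin ((t + h - x) / 2) * sin ((t - h - x) / 2).
    by rewrite -sin2_subr /Y; congr (_ ^+ 2 - _ ^+ 2); congr sin; field.
  by rewrite EX EY /A /B !cos_subr; ring.
have A_B : A - B = - 2 * (sin t * sin h) by rewrite /A /B cosD cosB; ring.
have nh : n%:R * h = pi / 2 by exact: natr_half_step.
have := fundP_mul_cos_subr n k (t + h) n0 kn.
have := fundP_mul_cos_subr n k (t - h) n0 kn.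
rewrite [n%:R * (t - h)]mulrBr [n%:R * (t + h)]mulrDr nh.
rewrite cosDpihalf cosBpihalf -/x -/A -/B => EB EA.
have nN0 : n%:R != 0 :> R by rewrite pnatr_eq0 -lt0n.
suff : GK_kernel n k t * (A * B) =
    (-1) ^+ k.+1 * sin (n%:R * t) * sin x / n%:R * (A - B).
  rewrite AB A_B XY exprS => E.
  apply: (@mulfI _ 4) => //; rewrite mulrCA E; field.
  by rewrite nN0.
rewrite /GK_kernel -/h.
transitivity ((fundP n k (t + h) * A) * B + (fundP n k (t - h) * B) * A).
  by ring.
by rewrite EA EB; ring.
Qed.

(** A Cauchy profile of width h: it serves both regimes at once and has an arctangent as
    primitive. *)
Definition lorentzian n k t : R :=
  (1 + ((t - cheb_angle n k) / half_step n) ^+ 2)^-1.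

Lemma norm_GK_kernel_le n k t : (0 < n)%N -> (0 < k <= n)%N -> 0 <= t <= pi ->
  `|GK_kernel n k t| <= 20 * lorentzian n k t.
Proof.
move=> n0 kn /andP[t0 tp]; rewrite /lorentzian.
set h := half_step n; set x := cheb_angle n k.
have h0 : 0 < h by exact: half_step_gt0.
have /andP[hx xh] : h <= x <= pi - h by exact: cheb_angle_itv.
set v := (t - x) / h.
have v0 : 0 <= v ^+ 2 by exact: sqr_ge0.
have v10 : 0 < 1 + v ^+ 2 by lra.
rewrite ler_pdivlMr//.
have uE : t - x = v * h by rewrite /v divfK ?gt_eqF.
(* For |t - x| <= 2h the trivial bound 4 suffices, as 4 (1 + v^2) <= 20; this fixes the constant
   20. *)
have [v2|v2] := lerP (v ^+ 2) 4.
  have : `|GK_kernel n k t| <= 4.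
    rewrite (le_trans (ler_normD _ _))//.
    have := norm_fundP_le n k (t + half_step n) n0 kn.
    have := norm_fundP_le n k (t - half_step n) n0 kn.
    lra.
  have := normr_ge0 (GK_kernel n k t); nra.
have [] := GK_kernel_identity n k t n0 kn; rewrite -/h -/x.
set X := sin ((t + x) / 2) ^+ 2 - _; set Y := sin ((t - x) / 2) ^+ 2 - _.
move=> XY E.
(* Here h^2 <= (t - x)^2 / 4, so [sin2_subr_ge] leaves 3/4 of (t - x)^2 / 16. *)
have Yge : 3 / 64 * (v ^+ 2 * h ^+ 2) <= Y.
  have u0 := normr_ge0 (t - x).
  have u2 : `|t - x| ^+ 2 = v ^+ 2 * h ^+ 2.
    by rewrite real_normK ?num_real// uE exprMn.
  have hu : h <= `|t - x|.
    rewrite leNgt; apply/negP => uh.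
    have : `|t - x| * `|t - x| <= h * h by apply: ler_pM => //; exact: ltW.
    have : 0 < h ^+ 2 by rewrite exprn_gt0.
    by rewrite -expr2 u2 -expr2; nra.
  have uph : `|t - x| + h <= pi by case: (ger0P (t - x)) => _; lra.
  have -> : Y = sin (`|t - x| / 2) ^+ 2 - sin (h / 2) ^+ 2.
    by rewrite /Y; case: (ger0P (t - x)) => // _; rewrite mulNr sinN sqrrN.
  apply: le_trans (@sin2_subr_ge R _ _ (ltW h0) hu uph).
  by rewrite u2; have := sqr_ge0 h; nra.
have h20 : 0 < h ^+ 2 by rewrite exprn_gt0.
have Y0 : 0 < Y by nra.
have Z0 : 0 <= X - Y.
  by rewrite XY mulr_ge0// sin_ge0_pi//; apply/andP; split; lra.
have X0 : 0 < X by lra.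
have n0R : 0 < n%:R :> R by rewrite ltr0n.
have nV : n%:R^-1 <= h.
  have := natr_half_step n n0 => /(_ R); rewrite -/h => nh.
  have p2 := pi_ge2 R.
  by rewrite -[n%:R^-1]mul1r ler_pdivrMr// mulrC nh; lra.
(* Multiplied by X this follows from the identity, with |sin(n t)| <= 1, |sin h| <= h, 1/(2n) <= h/2
   and 0 <= X - Y <= X. *)
have KY : `|GK_kernel n k t| * Y <= h ^+ 2 / 2.
  rewrite -(ler_pM2r X0).
  have -> : `|GK_kernel n k t| * Y * X = `|GK_kernel n k t * (X * Y)|.
    by rewrite !normrM (gtr0_norm X0) (gtr0_norm Y0); ring.
  rewrite E !normrM normrX normrN1 expr1n mul1r (ger0_norm Z0).
  apply: ler_pM => //.
    have -> : h ^+ 2 / 2 = 1 * h * (h / 2) by field.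
    apply: ler_pM => //.
      by apply: ler_pM => //; [exact: sin_max|exact: norm_sin_le (ltW h0)].
    by rewrite ger0_norm ?invr_ge0 ?mulr_ge0// invfM mulrC ler_wpM2r.
  by lra.
(* The constant is (1/2) / (3/64). As v^2 > 4, it also gives |K| <= 8/3, so |K| (1 + v^2) <=
   40/3. *)
have v2K : `|GK_kernel n k t| * v ^+ 2 <= 32 / 3.
  rewrite -(ler_pM2r h20).
  have := ler_wpM2l (normr_ge0 (GK_kernel n k t)) Yge.
  by lra.
by rewrite mulrDr mulr1; have := normr_ge0 (GK_kernel n k t); nra.
Qed.

End KernelBound.

(** * Integrating the kernel bound and summing over the nodes *)

Section L1Bound.
Context {R : realType}.
Import numFieldNormedType.Exports.
Local Open Scope classical_set_scope.
Implicit Types (n k : nat) (s t u x y : R).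
Local Notation mu := (@lebesgue_measure R).

Lemma continuous_GK_kernel n k : (0 < n)%N -> (0 < k <= n)%N ->
  continuous (@GK_kernel R n k).
Proof.
move=> n0 kn; have -> : @GK_kernel R n k = fun t =>
    n%:R^-1 * dirichlet_sum n (cheb_angle n k) (t + half_step n) +
    n%:R^-1 * dirichlet_sum n (cheb_angle n k) (t - half_step n).
  by apply/funext => t; rewrite /GK_kernel !fundPE.
move=> t; apply: cvgD; (apply: cvgM; first exact: cvg_cst);
  (apply: continuous_cvg; first exact: continuous_dirichlet_sum);
  (apply: cvgD; [exact: cvg_id|exact: cvg_cst]).
Qed.

Lemma continuous_lorentzian n k : continuous (@lorentzian R n k).
Proof.
move=> t; apply: cvgV.
  by rewrite gt_eqF// ltr_pwDl// sqr_ge0.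
apply: cvgD; first exact: cvg_cst.
by apply: cvgM; (apply: cvgM; last exact: cvg_cst);
  (apply: cvgD; [exact: cvg_id|exact: cvg_cst]).
Qed.

Lemma lorentzian_ge0 n k t : 0 <= lorentzian n k t.
Proof. by rewrite invr_ge0 addr_ge0// sqr_ge0. Qed.

(** The primitive is h atan((t - x_k)/h), and the arctangent varies by less than pi. *)
Lemma integral_lorentzian_le n k : (0 < n)%N ->
  (\int[mu]_(t in `[0%R, pi]) (lorentzian n k t)%:E <= (half_step n * pi)%:E)%E.
Proof.
move=> n0; have h0 : 0 < half_step n :> R by exact: half_step_gt0.
pose F t : R := half_step n * atan ((t - cheb_angle n k) / half_step n).
have dF t : is_derive t 1 F (lorentzian n k t).
  rewrite /F; apply: is_derive_eq.
  rewrite /GRing.scale/= mulr0 add0r subr0 mulr1 [_ * (half_step n)^-1]mulrC.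
  by rewrite mulVKf ?gt_eqF.
have cF : continuous F.
  by move=> t; apply/differentiable_continuous/derivable1_diffP; case: (dF t).
rewrite (@continuous_FTC2 _ _ F) ?pi_gt0//.
- rewrite -EFinB lee_fin /F -mulrBr ler_wpM2l ?ltW//.
  set a := (pi - _) / _; set b := (0 - _) / _.
  by have := atan_ltpi2 a; have := atan_gtNpi2 b; lra.
- by apply: continuous_in_subspaceT => x ?; exact: continuous_lorentzian.
- split.
  + by move=> x _; case: (dF x).
  + by apply: cvg_at_right_filter; exact: cF.
  + by apply: cvg_at_left_filter; exact: cF.
- by move=> x _; rewrite derive1E; case: (dF x).
Qed.

Local Notation I n k :=
  `[cheb_angle n k, (cheb_angle n k + pi / (2 * n%:R))%R : R].

Lemma sub_I_0pi n k : (0 < n)%N -> (0 < k <= n)%N -> I n k `<=` `[0, pi].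
Proof.
move=> n0 kn t; rewrite /= !in_itv/=; have := half_step_gt0 (R:=R) n n0.
have := cheb_angle_itv (R:=R) n k n0 kn; rewrite -/(half_step n).
by move=> /andP[? ?] ? /andP[? ?]; apply/andP; split; lra.
Qed.

(** Consecutive nodes are 2h apart while the intervals have length h, so the sum is one integral
    over a disjoint union inside [0, pi]. *)
Lemma sum_integral_I_le n (f : R -> R) : (0 < n)%N -> inL1 f ->
  (\sum_(1 <= k < n.+1) \int[mu]_(t in I n k) `|f t|%:E <= L1norm f)%E.
Proof.
move=> n0 fL1; have h0 := half_step_gt0 (R:=R) n n0.
have sub : \big[setU/set0]_(1 <= k < n.+1) I n k `<=` `[0, pi].
  rewrite -bigcup_seq => t [k/=]; rewrite mem_index_iota ltnS => kn.
  exact: (sub_I_0pi n k n0 kn).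
have mU : measurable (\big[setU/set0]_(1 <= k < n.+1) I n k).
  by apply: bigsetU_measurable => k _; exact: measurable_itv.
have mf : measurable_fun `[0, pi] (fun t => `|f t|%:E).
  apply/measurable_EFinP/measurableT_comp => //; apply/measurable_EFinP.
  by case/integrableP: fL1.
rewrite -ge0_integral_bigsetU//=.
- apply: ge0_subset_integral => //.
- exact: iota_uniq.
- apply/trivIsetP => i j _ _.
  wlog ij : i j / (i < j)%N.
    move=> H; rewrite neq_ltn => /orP[] ij; [|rewrite setIC];
      by apply: H => //; rewrite ltn_eqF.
  move=> _; rewrite -subset0 => t [] /=; rewrite !in_itv/= -/(half_step n).
  rewrite !cheb_angleE => /andP[_ a] /andP[b _].
  have : i%:R + 1 <= j%:R :> R by rewrite natr1 ler_nat.
  by nra.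
- exact: measurable_funS mf.
Qed.

(** The range of k is repeated as a filter so that termwise arguments can use it. *)
Lemma GK_sumE n (f : R -> R) : GK n f = fun t =>
  \sum_(1 <= k < n.+1 | (0 < k < n.+1)%N)
    (n%:R / pi * \int[mu]_(s in I n k) f s) * GK_kernel n k t.
Proof.
apply/funext => t; rewrite /GK mulr_sumr -big_nat.
by apply: eq_bigr => k _; rewrite mulrA.
Qed.

Lemma continuous_GK n (f : R -> R) : (0 < n)%N -> continuous (GK n f).
Proof.
move=> n0; rewrite GK_sumE => t.
apply: cvg_big => [|k kn]; first exact: add_continuous.
by apply: cvgM; [exact: cvg_cst|exact: continuous_GK_kernel].
Qed.

Lemma inL1_GK n (f : R -> R) : (0 < n)%N -> inL1 (GK n f).
Proof.
move=> n0; apply: continuous_compact_integrable; first exact: segment_compact.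
exact/continuous_subspaceT/continuous_GK.
Qed.

Lemma L1norm_GK_le n (f : R -> R) : (0 < n)%N -> inL1 f ->
  (L1norm (GK n f) <= (10 * pi)%:E * L1norm f)%E.
Proof.
move=> n0 fL1; have pi0 : 0 < pi :> R := pi_gt0 R.
pose a k := n%:R / pi * \int[mu]_(s in I n k) f s.
have mGK := inL1_GK n f n0.
have mlorentzian k : measurable_fun `[0, pi] (fun t => (lorentzian n k t)%:E).
  apply/measurable_EFinP; apply: measurable_funTS.
  by apply: continuous_measurable_fun; exact: continuous_lorentzian.
(* An integrable majorant of |GK_n f|, whose terms are nonnegative so that sum and integral
   commute. *)
pose g t := (\sum_(1 <= k < n.+1) (20 * `|a k|)%:E * (lorentzian n k t)%:E)%E.
have intg : (\int[mu]_(t in `[0%R, pi]) g t =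
   \sum_(1 <= k < n.+1) (20 * `|a k|)%:E *
     \int[mu]_(t in `[0%R, pi]) (lorentzian n k t)%:E)%E.
  rewrite ge0_integral_sum//=.
  - apply: eq_bigr => k _; rewrite ge0_integralZl//=; first exact: mlorentzian.
    by move=> t _; rewrite lee_fin lorentzian_ge0.
  - move=> k; apply: measurable_funeM; exact: mlorentzian.
  - by move=> k t _; rewrite -EFinM lee_fin !mulr_ge0// lorentzian_ge0.
apply: (@le_trans _ _ (\int[mu]_(t in `[0%R, pi]) g t)%E).
  apply: ge0_le_integral => //=.
  - apply/measurable_EFinP/measurableT_comp => //; apply/measurable_EFinP.
    by case/integrableP: mGK.
  - apply: emeasurable_sum => k; apply: measurable_funeM; exact: mlorentzian.
  - move=> t; rewrite /= in_itv/= => t0p.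
    have -> : g t = (\sum_(1 <= k < n.+1) 20 * `|a k| * lorentzian n k t)%:E.
      by rewrite -sumEFin.
    rewrite GK_sumE lee_fin (le_trans (ler_norm_sum _ _ _))//.
    rewrite [leRHS]big_nat; apply: ler_sum => k kn.
    rewrite normrM -/(a k) [20 * _]mulrC -mulrA.
    by rewrite ler_wpM2l// norm_GK_kernel_le.
rewrite intg.
apply: le_trans (lee_wpmul2l _ (sum_integral_I_le n f n0 fL1)); last first.
  by rewrite lee_fin mulr_ge0// ltW.
rewrite ge0_sume_distrr; last by move=> k _; exact: integral_ge0.
rewrite !big_nat; apply: lee_sum => k kn.
apply: (@le_trans _ _ ((20 * `|a k|)%:E * (half_step n * pi)%:E)%E).
  apply: lee_wpmul2l; first by rewrite lee_fin mulr_ge0.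
  exact: integral_lorentzian_le.
rewrite -EFinM /a normrM (ger0_norm (divr_ge0 (ler0n _ _) (ltW pi0))).
(* The factor pi cancels and n h = pi/2 removes the dependence on n. *)
have -> : 20 * (n%:R / pi * `|\int[mu]_(s in I n k) f s|) * (half_step n * pi)
    = 10 * pi * `|\int[mu]_(s in I n k) f s|.
  have := @natr_half_step R n n0 => nh.
  transitivity (20 * (n%:R * half_step n) * `|\int[mu]_(s in I n k) f s| *
                (pi / pi)); first by ring.
  by rewrite nh divff ?gt_eqF//; field.
rewrite EFinM; apply: lee_wpmul2l; first by rewrite lee_fin mulr_ge0// ltW.
have mI : measurable (I n k : set R) by exact: measurable_itv.
have fI : mu.-integrable (I n k) (EFin \o f).
  by apply: integrableS fL1 => //; exact: sub_I_0pi.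
rewrite EFin_normr_Rintegral//.
by apply: le_abse_integral => //; case/integrableP: fI.
Qed.

End L1Bound.

Theorem lemma3p2 (R : realType) :
  exists2 C : R, 0 < C &
    forall (n : nat) (f : R -> R), (0 < n)%N -> inL1 f ->
      inL1 (GK n f) /\ (L1norm (GK n f) <= C%:E * L1norm f)%E.
Proof.
exists (10 * pi); first by rewrite mulr_gt0// pi_gt0.
by move=> n f n0 fL1; split; [exact: inL1_GK|exact: L1norm_GK_le].
Qed.
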